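(* There are infinitely many pairwise non-isomorphic 3-connected claw-free graphs $G$ for which there exist six distinct vertices $x_1,\dots,x_6$ and a seventh vertex $z\in V(G)\setminus\{x_1,\dots,x_6\}$ such that $G$ has no cycle containing all of $x_1,\dots,x_6$ and avoiding $z$.
   Context: Graphs are finite and simple. A graph is claw-free if it contains no induced subgraph isomorphic to $K_{1,3}$. *)

(* Defs.v *)
From mathcomp Require Import all_boot.

Set Implicit Arguments.
Unset Strict Implicit.
Unset Printing Implicit Defensive.

Record sgraph := SGraph {
  vertex :> finType;
  adj : rel vertex;
  adj_sym : symmetric adj;
  adj_irrefl : irreflexive adj }.

Definition iso (G H : sgraph) : Prop :=
  exists f : G -> H, bijective f /\ forall x y, adj (f x) (f y) = adj x y.

Definition induced_adj (G : sgraph) (S : {set G}) : rel {x : G | x \in S} :=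
  [rel u v | adj (val u) (val v)].

Lemma induced_sym (G : sgraph) (S : {set G}) : symmetric (@induced_adj G S).
Proof. by move=> u v; apply: adj_sym. Qed.

Lemma induced_irrefl (G : sgraph) (S : {set G}) :
  irreflexive (@induced_adj G S).
Proof. by move=> u; apply: adj_irrefl. Qed.

Definition induced (G : sgraph) (S : {set G}) : sgraph :=
  SGraph (@induced_sym G S) (@induced_irrefl G S).

(* K_{1,n}: the centre is None, the leaves are Some i. *)
Definition star_adj (n : nat) : rel (option 'I_n) :=
  [rel u v | (u == None) (+) (v == None)].

Lemma star_sym (n : nat) : symmetric (@star_adj n).
Proof. by move=> u v; apply: addbC. Qed.

Lemma star_irrefl (n : nat) : irreflexive (@star_adj n).
Proof. by move=> u; apply: addbb. Qed.

Definition star (n : nat) : sgraph := SGraph (@star_sym n) (@star_irrefl n).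

Definition claw_free (G : sgraph) : Prop :=
  ~ exists S : {set G}, iso (induced S) (star 3).

Definition connected (G : sgraph) : Prop :=
  0 < #|G| /\ forall x y : G, connect (@adj G) x y.

Definition k_connected (k : nat) (G : sgraph) : Prop :=
  k < #|G| /\ forall X : {set G}, #|X| < k -> connected (induced (~: X)).

(* A cycle is given by its cyclic sequence of distinct vertices; the size bound
   excludes the empty sequence and the two traversals u, v of a single edge,
   which [ucycle] accepts. *)
Definition is_cycle (G : sgraph) (c : seq G) : Prop :=
  2 < size c /\ ucycle (@adj G) c.

(* Main.v *)
Require Import Defs.
From mathcomp Require Import all_boot.

(** Let e = uv be an edge of the Petersen graph P, and let X consist of u, v and
    the four vertices at distance 2 from e.  The graph P - e has no cycle
    through X: the degree conditions force such a cycle to contain the other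
    two edges at each of u and v, hence to be one of two 2-factors of P into two
    5-cycles, with u and v on different components.  Attach a pendant edge at
    each vertex of X, and n more at u; the line graph of the result is claw-free
    and 3-connected, and a cycle of it through the pendant edges at X avoiding
    the vertex z = e would give a cycle of P - e through X.

    This last step needs no reconstruction of the cycle of P.  Label each pair
    of consecutive vertices of a cycle of the line graph by a common end in P,
    and call an edge traversed when the labels before and after it differ.  As
    the labels are cyclic, the traversed edges meet every edge cut of P in an
    even number of edges, and in at least one if the cut separates two labels;
    the label at a pendant edge is its end in P.  These parity conditions, at
    the stars of the vertices and at two further cuts, are contradictory. *)

Set Implicit Arguments.
Unset Strict Implicit.
Unset Printing Implicit Defensive.

Section LineGraph.

Variables (T : finType) (V : eqType) (ends : T -> V * V).

Definition incident (v : V) (t : T) := (v == (ends t).1) || (v == (ends t).2).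

(* Loops (t with equal ends) are allowed, and stand for pendant edges. *)
Definition line_adj : rel T :=
  [rel s t | (s != t) && (incident (ends s).1 t || incident (ends s).2 t)].

Lemma line_adjP s t :
  reflect (s != t /\ exists2 v, incident v s & incident v t) (line_adj s t).
Proof.
apply: (iffP andP) => [[st ist]|[st [v ivs ivt]]]; split=> //.
  by case/orP: ist => it; [exists (ends s).1 | exists (ends s).2];
    rewrite // /incident eqxx ?orbT.
by case/orP: ivs => /eqP <-; rewrite ivt ?orbT.
Qed.

Lemma line_adj_sym : symmetric line_adj.
Proof.
by move=> s t; apply/line_adjP/line_adjP => -[st [v ivs ivt]]; split;
  rewrite 1?eq_sym //; exists v.
Qed.

Lemma line_adj_irrefl : irreflexive line_adj.
Proof. by move=> s; rewrite /line_adj /= eqxx. Qed.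

Definition line_graph := SGraph line_adj_sym line_adj_irrefl.

(** Each leaf of a claw contains an end of the centre, so two of three leaves share one and are
    adjacent. *)
Lemma line_graph_claw_free : claw_free line_graph.
Proof.
move=> [S [f [[g fK gK] f_adj]]].
pose c := val (g None); pose l i : T := val (g (Some i)).
have l_inj : injective l by move=> i j /val_inj /(can_inj gK) [].
have g_adj a b : line_adj (val (g a)) (val (g b)) = star_adj a b.
  by have /esym := f_adj (g a) (g b); rewrite !gK.
have adj_cl i : incident (ends c).1 (l i) || incident (ends c).2 (l i).
  by have /andP[] : line_adj c (l i) by rewrite g_adj.
have sep v i j : i != j -> incident v (l i) -> incident v (l j) -> False.
  move=> ij ivi ivj; have := g_adj (Some i) (Some j) => /= /negP[].
  by apply/line_adjP; split; [rewrite (inj_eq l_inj) | exists v].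
have := adj_cl (inord 0); have := adj_cl (inord 1); have := adj_cl (inord 2).
have ne a b : a < 3 -> b < 3 -> a != b -> (inord a : 'I_3) != inord b.
  by move=> ha hb; rewrite -(inj_eq val_inj) /= !inordK.
by case/orP=> i2; case/orP=> i1; case/orP=> i0;
  first [exact: (sep _ _ _ (ne 0 1 isT isT isT) i0 i1)
        | exact: (sep _ _ _ (ne 0 2 isT isT isT) i0 i2)
        | exact: (sep _ _ _ (ne 1 2 isT isT isT) i1 i2)].
Qed.

Variable c : seq T.
Hypothesis c_cycle : ucycle line_adj c.

Let c_uniq : uniq c. Proof. by case/andP: c_cycle. Qed.

Definition link (t : T) : V :=
  if incident (ends t).1 (next c t) then (ends t).1 else (ends t).2.

Definition traversed (t : T) := link (prev c t) != link t.

Lemma incident_link t : incident (link t) t.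
Proof. by rewrite /link /incident; case: ifP; rewrite eqxx ?orbT. Qed.

Lemma incident_link_prev t : t \in c -> incident (link (prev c t)) t.
Proof.
move=> tc; have ptc : prev c t \in c by rewrite mem_prev.
have /andP[c_adj _] := c_cycle.
have := next_cycle c_adj ptc; rewrite /= next_prev // => /andP[_].
by rewrite /link next_prev //; case: ifP.
Qed.

(** Both labels around [t] are ends of [t]; if they differ, they are its two ends. *)
Lemma link_switch (S : pred V) t : t \in c ->
  S (link (prev c t)) (+) S (link t) =
  (S (ends t).1 (+) S (ends t).2) && traversed t.
Proof.
move=> tc; rewrite /traversed; have := incident_link t.
have := incident_link_prev tc.
by do 2![case/orP => /eqP->]; rewrite ?eqxx ?addbb ?andbF //;
  case: eqP => [->|]; rewrite ?addbb ?andbT // addbC.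
Qed.

(** Each label enters the sum twice, as [prev c] permutes the cycle. *)
Lemma even_traversed_cut (S : pred V) :
  \big[addb/false]_(t in c)
     ((S (ends t).1 (+) S (ends t).2) && traversed t) = false.
Proof.
rewrite -big_uniq // big_seq -(eq_bigr _ (link_switch S)) -big_seq big_split /=.
rewrite -(big_map (prev c) xpredT (fun t => S (link t))).
suff /(perm_big _) -> : perm_eq (map (prev c) c) c by rewrite addbb.
have pc_uniq : uniq (map (prev c) c).
  by rewrite map_inj_uniq //; apply: can_inj (next_prev c_uniq).
apply: uniq_perm => // t; apply/mapP/idP => [[s sc ->]|tc].
  by rewrite mem_prev.
by exists (next c t); rewrite ?mem_next ?prev_next.
Qed.

(** Otherwise [S] would be constant on the labels along the cycle. *)
Lemma traversed_cut (S : pred V) s t : s \in c -> t \in c ->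
    S (link s) != S (link t) ->
  exists2 r, r \in c & (S (ends r).1 (+) S (ends r).2) && traversed r.
Proof.
move=> sc tc Sst.
case: (boolP [exists r in c, (S (ends r).1 (+) S (ends r).2) && traversed r]).
  by case/exists_inP => r; exists r.
move=> /exists_inPn noS; case/eqP: Sst.
pose e := [rel x y | S (link x) == S (link y)].
have e_cycle : cycle e c.
  apply: cycle_from_prev => // x xc; have := noS x xc.
  by rewrite -link_switch //= negb_add.
have /connectP[p + ->] := connect_cycle e_cycle sc tc.
by elim: p s {sc} => //= y p IHp s /andP[/eqP-> /IHp].
Qed.

End LineGraph.

(* Here u = 0 and v = 1, e is edge 0, and X = {0, ..., 5}. *)
Definition petersen : seq (nat * nat) :=
  [:: (0, 1); (0, 6); (0, 7); (1, 8); (1, 9); (6, 2); (6, 4); (7, 5); (7, 3);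
      (8, 2); (8, 5); (9, 4); (9, 3); (2, 3); (4, 5)].

Section Construction.

Variable n : nat.

Definition pendant_end (j : nat) := if j < 6 then j else 0.

Definition ends (t : 'I_15 + 'I_(6 + n)) : nat * nat :=
  match t with
  | inl i => nth (0, 0) petersen i
  | inr j => (pendant_end j, pendant_end j)
  end.

Definition petersen_line_graph := line_graph ends.

Lemma card_petersen_line_graph : #|petersen_line_graph| = 21 + n.
Proof. by rewrite card_sum !card_ord addnA. Qed.

End Construction.

Definition touch (p q : nat * nat) :=
  ((p.1 == q.1) || (p.1 == q.2)) || ((p.2 == q.1) || (p.2 == q.2)).

Definition surviving (f g : nat) :=
  [seq i <- iota 0 15 | (i != f) && (i != g)].

Definition grow (r s : seq nat) : seq nat :=
  [seq i <- r | (i \in s) || has (fun j => touch (nth (0, 0) petersen j)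
                                                (nth (0, 0) petersen i)) s].

(* After deletion of f and g, the remaining edges of P are all reached from the
   first of them within 4 steps, and each vertex of X is still on one. *)
Definition robust (f g : nat) : bool :=
  let r := surviving f g in
  let s := iter 4 (grow r) [:: head 15 r] in
  [&& r != [::], all [in s] r
    & all (fun a => has (fun i => touch (a, a) (nth (0, 0) petersen i)) r)
          (iota 0 6)].

(** Index 15 deletes nothing, so this covers all deletions of at most two edges. *)
Lemma petersen_robust : all (fun f => all (robust f) (iota 0 16)) (iota 0 16).
Proof. by vm_compute. Qed.

Lemma no_even_subgraph (b : nat -> bool) :
  let cut (S : pred nat) k :=
    let p := nth (0, 0) petersen k in (S p.1 (+) S p.2) && b k in
  b 0 = false ->
  (forall S : pred nat, foldr addb false (map (cut S) (iota 0 15)) = false) ->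
  (forall (S : pred nat) u v, u < 6 -> v < 6 -> S u != S v ->
     has (cut S) (iota 0 15)) ->
  False.
Proof.
move=> cut b0 even sep.
have ev v := even (pred1 v).
have nz v : v < 6 -> has (cut (pred1 v)) (iota 0 15).
  (* The number [v == 0] is 1 or 0, a vertex of X other than [v]. *)
  move=> v6; apply: (sep _ v (v == 0 : nat)) => //; first by case: v v6.
  by rewrite /= eqxx; case: v v6.
(* The 2-factors left by the degree conditions each have one of these vertex
   sets as the component of u = 0. *)
have s1 := sep [in [:: 0; 6; 2; 3; 7]] 0 1 isT isT isT.
have s2 := sep [in [:: 0; 6; 4; 5; 7]] 0 1 isT isT isT.
move: (ev 0) (nz 0 isT) (ev 1) (nz 1 isT) (ev 6) (ev 7) (ev 8) (ev 9)
  (ev 2) (nz 2 isT) (ev 3) (nz 3 isT) (ev 4) (nz 4 isT) (ev 5) (nz 5 isT) s1 s2.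
rewrite /cut /= b0 {cut b0 even sep ev nz}.
(* The edges other than e at 0 and 1 are forced, then one of two at each of 6, 7, 8, 9; the stars of
   2 to 5 and the two cuts refute all sixteen choices. *)
case: (b 1); case: (b 2) => //= _ _; case: (b 3); case: (b 4) => //= _ _.
case: (b 5); case: (b 6) => //= _; case: (b 7); case: (b 8) => //= _;
case: (b 9); case: (b 10) => //= _; case: (b 11); case: (b 12) => //= _;
by case: (b 13); case: (b 14).
Qed.

Section Properties.

Variable n : nat.

Let G := petersen_line_graph n.

Let core (i : 'I_15) : G := inl i.

Definition core_index (t : 'I_15 + 'I_(6 + n)) : nat :=
  if t is inl i then i else 15.

Lemma core_index_le t : core_index t \in iota 0 16.
Proof. by rewrite mem_iota; case: t => //= i; apply: (leqW (ltn_ord i)). Qed.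

(* The value 15, the index of no core edge, fills in when X has fewer than two
   core edges. *)
Lemma deleted_pair (X : {set G}) : #|X| < 3 ->
  exists f g, [/\ f \in iota 0 16, g \in iota 0 16 &
    forall i, (core i \in X) = (i == f :> nat) || (i == g :> nat)].
Proof.
have core_eqE i t : (core i == t) = (i == core_index t :> nat).
  case: t => [j|j] /=; first by apply/eqP/eqP => [[->]|/val_inj->].
  by rewrite ltn_eqF.
rewrite cardE => sX.
pose k m := nth 15 (map core_index (enum X)) m.
have k16 m : k m \in iota 0 16.
  have [mX|mX] := ltnP m (size (map core_index (enum X))).
    by have /mapP[t _ Et] := mem_nth 15 mX; rewrite /k Et core_index_le.
  by rewrite /k nth_default.
exists (k 0), (k 1); split=> // i; rewrite -mem_enum /k.
by case: (enum X) sX => [|f [|g []]] //= _; rewrite ?inE ?core_eqE //;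
  rewrite ?(ltn_eqF (ltn_ord i)) ?orbF.
Qed.

(** Every pendant edge meets a surviving core edge, and [robust] connects the core. *)
Lemma petersen_connected (X : {set G}) : #|X| < 3 -> connected (induced (~: X)).
Proof.
case/deleted_pair => f [g [f16 g16 Xfg]].
have /allP/(_ _ f16)/allP/(_ _ g16) := petersen_robust.
rewrite /robust; set r := surviving f g; set s := iter _ _ _.
case/and3P => r_n0 /allP rs /allP pend.
have r15 k : k \in r -> k < 15 by rewrite mem_filter mem_iota => /andP[].
have coreX (i : 'I_15) : (core i \in ~: X) = ((i : nat) \in r).
  by rewrite inE Xfg mem_filter mem_iota /= ltn_ord andbT negb_or.
have k0r : head 15 r \in r by case: (r) r_n0 => //= k l _; apply: mem_head.
have ord_of k : k \in r -> exists2 i : 'I_15, i = k :> nat & core i \in ~: X.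
  by move=> kr; exists (Ordinal (r15 k kr)); rewrite ?coreX.
have [i0 i0k0 i0X] := ord_of _ k0r.
pose H := induced (~: X); pose x0 : H := exist _ (core i0) i0X.
have reach m k : k \in iter m (grow r) [:: head 15 r] ->
    k \in r /\ forall i (iX : core i \in ~: X), i = k :> nat ->
      connect (@adj H) x0 (exist _ (core i) iX).
  elim: m k => [|m IHm] k /=.
    rewrite inE => /eqP->; split=> // i iX ik; apply: eq_connect0.
    by apply: val_inj; congr inl; apply: val_inj; rewrite /= ik.
  rewrite mem_filter => /andP[+ kr].
  case/orP => [/IHm //|/hasP[j /IHm[jr x0j]] jk].
  split=> // i iX ik; have [i' i'j i'X] := ord_of j jr.
  apply: connect_trans (x0j i' i'X i'j) _.
  have [-> //|i'i] := eqVneq (exist _ (core i') i'X : H) (exist _ (core i) iX).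
  by apply: connect1; apply/andP; split; rewrite //= /incident /= ik i'j.
have x0_core i (iX : core i \in ~: X) :
    connect (@adj H) x0 (exist _ (core i) iX).
  have ir : (i : nat) \in r by rewrite -coreX.
  by have [_] := reach _ _ (rs _ ir); apply.
have x0_all x : connect (@adj H) x0 x.
  case: x => [[i|j] xX]; first exact: x0_core.
  have a6 : pendant_end j \in iota 0 6.
    by rewrite mem_iota /pendant_end; case: ifP.
  have /hasP[k /ord_of[i <- iX] jk] := pend _ a6.
  apply: connect_trans (x0_core i iX) (connect1 _).
  by rewrite adj_sym; apply/andP; split.
split=> [|x y]; first by apply/card_gt0P; exists x0.
by apply: connect_trans (x0_all y); rewrite (sym_connect_sym (@adj_sym H)).
Qed.

Lemma petersen_3connected : k_connected 3 G.
Proof.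
by split; [rewrite card_petersen_line_graph | apply: petersen_connected].
Qed.

Definition target (j : 'I_6) : G := inr (lshift n j).

Lemma petersen_no_cycle (c : seq G) :
  is_cycle c -> (forall j, target j \in c) -> core ord0 \notin c -> False.
Proof.
case=> _ c_cycle xc zc.
pose b k := (core (inord k) \in c) && traversed (@ends n) c (core (inord k)).
have link_target (v : nat) (v6 : v < 6) :
    link (@ends n) c (target (Ordinal v6)) = v.
  have := incident_link (@ends n) c (target (Ordinal v6)).
  by rewrite /incident /= /pendant_end v6 orbb => /eqP.
apply: (@no_even_subgraph b).
- rewrite /b (_ : inord 0 = ord0) ?(negPf zc) //.
  by apply: val_inj; rewrite /= inordK.
- move=> S; rewrite foldrE big_map -[iota 0 15]/(index_iota 0 15) big_mkord.
  apply: etrans (even_traversed_cut c_cycle S).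
  (* Pendant edges are loops, so they lie in no cut. *)
  rewrite [RHS]big_mkcond big_sumType /= [X in _ (+) X]big1 ?addbF.
    apply: eq_bigr => i _; rewrite /b inord_val.
    by rewrite /core; case: (_ \in c); rewrite ?andbF.
  by move=> i _; rewrite addbb /= if_same.
move=> S u v u6 v6 Suv.
have := traversed_cut c_cycle (xc (Ordinal u6)) (xc (Ordinal v6)).
rewrite !link_target => /(_ _ Suv)[[i|j] ic tr].
  apply/hasP; exists (i : nat); first by rewrite mem_iota /=.
  by rewrite /b inord_val [_ \in _]ic.
by rewrite addbb in tr.
Qed.

End Properties.

Theorem mainTheorem6 :
  exists G : nat -> sgraph,
    (forall m n : nat, m <> n -> ~ iso (G m) (G n)) /\
    (forall n : nat,
       k_connected 3 (G n) /\ claw_free (G n) /\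
       exists (x : 'I_6 -> G n) (z : G n),
         injective x /\ (forall i : 'I_6, z <> x i) /\
         ~ exists c : seq (G n),
             is_cycle c /\ (forall i : 'I_6, x i \in c) /\ z \notin c).
Proof.
exists petersen_line_graph; split=> [m n mn [f [f_bij _]]|n].
  by have := bij_eq_card f_bij; rewrite !card_petersen_line_graph => /addnI.
split; first exact: petersen_3connected.
split; first exact: line_graph_claw_free.
exists (@target n), (inl ord0); split; first by move=> i j [] /val_inj.
by split=> // -[c [c_cycle [xc zc]]]; apply: petersen_no_cycle c_cycle xc zc.
Qed.
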